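(* Let $E$ be a propositional variable and $\delta$ a new atomic formula symbol. Then $\mathsf{QLP}^-(\delta\leftrightarrow[E\wedge\neg(\exists x)x:(\delta\rightarrow E)])_{\emptyset}\nvdash\neg\delta$, where this logic is $\mathsf{QLP}^-$ without Axiom Necessitation, over the language extended by $\delta$, with the single additional axiom $\delta\leftrightarrow[E\wedge\neg(\exists x)x:(\delta\rightarrow E)]$.
   Context: Fix countably many justification variables, propositional variables, and primitive function symbols of each arity $n\ge0$; a primitive term is $f(x_1,\dots,x_n)$. Terms of $\mathsf{QLP}^-$: $t::= x\mid f(x_1,\dots,x_n)\mid t\cdot t\mid t+t\mid !t$. Formulas: $A::= p\mid\bot\mid\neg A\mid A\wedge A\mid A\vee A\mid A\rightarrow A\mid t:A\mid(\forall x)A\mid(\exists x)A$. Axioms: all propositional tautologies; Q1: $(\forall x)A(x)\rightarrow A(t)$, $t$ free for $x$; Q2: $(\forall x)(A\rightarrow B(x))\rightarrow(A\rightarrow(\forall x)B(x))$, $x$ not free in $A$; Q3: $A(t)\rightarrow(\exists x)A(x)$, $t$ free for $x$; Q4: $(\forall x)(A(x)\rightarrow B)\rightarrow((\exists x)A(x)\rightarrow B)$, $x$ not free in $B$; jK: $s:(A\rightarrow B)\rightarrow(t:A\rightarrow(s\cdot t):B)$; jT: $t:A\rightarrow A$; j4: $t:A\rightarrow !t:t:A$; Sum: $s:A\rightarrow(s+t):A$, $s:A\rightarrow(t+s):A$. Rules: Modus Ponens; Gen: from $A$ infer $(\forall x)A$; Axiom Necessitation: from an axiom instance $A$ infer $f(x_1,\dots,x_n):A$.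 The subscript $\emptyset$ means Axiom Necessitation is dropped. All schemes and rules apply to formulas of the extended language. *)

(* Defs.v *)
From mathcomp Require Import all_boot.

Set Implicit Arguments.
Unset Strict Implicit.
Unset Printing Implicit Defensive.

Definition jvar := nat.
Definition pvar := nat.

(* [Prim k xs] with [xs : n.-tuple jvar] applies the k-th primitive function
   symbol of arity n; its arguments are justification variables, never
   compound terms. *)
Inductive term : Type :=
| Var of jvar
| Prim (n k : nat) of n.-tuple jvar
| App of term & term
| Plus of term & term
| Bang of term.

(* [Delta] is the new atomic formula symbol added to the language of QLP^-. *)
Inductive form : Type :=
| PVar of pvar
| Delta
| Bot
| Neg of form
| And of form & form
| Or of form & form
| Imp of form & form
| Just of term & form
| All of jvar & form
| Ex of jvar & form.

Definition Iff (A B : form) : form := And (Imp A B) (Imp B A).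

Fixpoint occurs (x : jvar) (s : term) : bool :=
  match s with
  | Var y => y == x
  | Prim _ _ xs => x \in xs
  | App s1 s2 | Plus s1 s2 => occurs x s1 || occurs x s2
  | Bang s1 => occurs x s1
  end.

Fixpoint free (x : jvar) (A : form) : bool :=
  match A with
  | PVar _ | Delta | Bot => false
  | Neg B => free x B
  | And B C | Or B C | Imp B C => free x B || free x C
  | Just s B => occurs x s || free x B
  | All y B | Ex y B => (y != x) && free x B
  end.

Definition omap2 (S T U : Type) (f : S -> T -> U) (a : option S) (b : option T)
    : option U :=
  obind (fun s => omap (f s) b) a.

(* Substitution of [t] for the free occurrences of [x].  It is partial: as
   primitive function symbols take only variables as arguments, a non-variable
   [t] cannot replace an [x] occurring among such arguments. *)
Fixpoint tsubst (x : jvar) (t s : term) : option term :=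
  match s with
  | Var y => Some (if y == x then t else Var y)
  | Prim n k xs =>
      if x \in xs then
        if t is Var z
        then Some (Prim k (map_tuple (fun y => if y == x then z else y) xs))
        else None
      else Some (Prim k xs)
  | App s1 s2 => omap2 App (tsubst x t s1) (tsubst x t s2)
  | Plus s1 s2 => omap2 Plus (tsubst x t s1) (tsubst x t s2)
  | Bang s1 => omap Bang (tsubst x t s1)
  end.

Fixpoint subst (x : jvar) (t : term) (A : form) : option form :=
  match A with
  | PVar _ | Delta | Bot => Some A
  | Neg B => omap Neg (subst x t B)
  | And B C => omap2 And (subst x t B) (subst x t C)
  | Or B C => omap2 Or (subst x t B) (subst x t C)
  | Imp B C => omap2 Imp (subst x t B) (subst x t C)
  | Just s B => omap2 Just (tsubst x t s) (subst x t B)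
  | All y B => if y == x then Some A else omap (All y) (subst x t B)
  | Ex y B => if y == x then Some A else omap (Ex y) (subst x t B)
  end.

(* [t] is free for [x] in [A]: no free occurrence of [x] in [A] is in the scope
   of a quantifier binding a variable of [t]. *)
Fixpoint free_for (t : term) (x : jvar) (A : form) : bool :=
  match A with
  | PVar _ | Delta | Bot => true
  | Neg B | Just _ B => free_for t x B
  | And B C | Or B C | Imp B C => free_for t x B && free_for t x C
  | All y B | Ex y B =>
      ~~ free x A || (~~ occurs y t && free_for t x B)
  end.

(* Truth under a classical valuation [v] of the formulas that are not built
   by a Boolean connective, all of which are treated as atoms. *)
Fixpoint eval (v : form -> bool) (A : form) : bool :=
  match A with
  | Bot => false
  | Neg B => ~~ eval v B
  | And B C => eval v B && eval v C
  | Or B C => eval v B || eval v C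
  | Imp B C => eval v B ==> eval v C
  | _ => v A
  end.

Definition tautology (A : form) : Prop := forall v : form -> bool, eval v A.

Inductive QLPm_axiom : form -> Prop :=
| AxTaut A : tautology A -> QLPm_axiom A
| AxQ1 x t A At : free_for t x A -> subst x t A = Some At ->
    QLPm_axiom (Imp (All x A) At)
| AxQ2 x A B : ~~ free x A ->
    QLPm_axiom (Imp (All x (Imp A B)) (Imp A (All x B)))
| AxQ3 x t A At : free_for t x A -> subst x t A = Some At ->
    QLPm_axiom (Imp At (Ex x A))
| AxQ4 x A B : ~~ free x B ->
    QLPm_axiom (Imp (All x (Imp A B)) (Imp (Ex x A) B))
| AxjK s t A B :
    QLPm_axiom (Imp (Just s (Imp A B)) (Imp (Just t A) (Just (App s t) B)))
| AxjT t A : QLPm_axiom (Imp (Just t A) A)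
| Axj4 t A : QLPm_axiom (Imp (Just t A) (Just (Bang t) (Just t A)))
| AxSuml s t A : QLPm_axiom (Imp (Just s A) (Just (Plus s t) A))
| AxSumr s t A : QLPm_axiom (Imp (Just s A) (Just (Plus t s) A)).

(* Theorems of QLP^-(F) with the empty subscript: [F] is the single additional
   axiom and there is no Axiom Necessitation rule. *)
Inductive QLPm_empty (F : form) : form -> Prop :=
| PrAxiom A : QLPm_axiom A -> QLPm_empty F A
| PrExtra : QLPm_empty F F
| PrMP A B : QLPm_empty F (Imp A B) -> QLPm_empty F A -> QLPm_empty F B
| PrGen x A : QLPm_empty F A -> QLPm_empty F (All x A).

(* Main.v *)
Require Import Defs.
From mathcomp Require Import all_boot.

(** Without Axiom Necessitation nothing forces any formula to be justified.
    Reading every [t : A] as false makes terms irrelevant, so quantifiers can be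
    erased; taking all atoms to be true then validates every axiom and rule as
    well as the additional axiom, while [Delta] is true. *)

Fixpoint unjustified_eval (A : form) : bool :=
  match A with
  | PVar _ | Delta => true
  | Bot | Just _ _ => false
  | Neg B => ~~ unjustified_eval B
  | And B C => unjustified_eval B && unjustified_eval C
  | Or B C => unjustified_eval B || unjustified_eval C
  | Imp B C => unjustified_eval B ==> unjustified_eval C
  | All _ B | Ex _ B => unjustified_eval B
  end.

(** Serves the tautology axioms: the valuation is only consulted at non-Boolean formulas, so
    [unjustified_eval] can serve as its own valuation. *)
Lemma eval_unjustified A : eval unjustified_eval A = unjustified_eval A.
Proof. by elim: A => //= [B ->|B -> C ->|B -> C ->|B -> C ->]. Qed.

(** Substitution alters only terms, which the evaluation never inspects. *)
Lemma unjustified_eval_subst x t A At :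
  subst x t A = Some At -> unjustified_eval At = unjustified_eval A.
Proof.
elim: A At => [p|||B IHB|B IHB C IHC|B IHB C IHC|B IHB C IHC|s B IHB|y B IHB
              |y B IHB] At /=.
1-3: by move=> [<-].
- by case: (subst x t B) IHB => //= B' IHB [<-] /=; rewrite (IHB B').
- case: (subst x t B) IHB => //= B' IHB; case: (subst x t C) IHC => //= C' IHC.
  by move=> [<-] /=; rewrite (IHB B') // (IHC C').
- case: (subst x t B) IHB => //= B' IHB; case: (subst x t C) IHC => //= C' IHC.
  by move=> [<-] /=; rewrite (IHB B') // (IHC C').
- case: (subst x t B) IHB => //= B' IHB; case: (subst x t C) IHC => //= C' IHC.
  by move=> [<-] /=; rewrite (IHB B') // (IHC C').
- by case: (tsubst x t s) => //= s'; case: (subst x t B) => //= B' [<-].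
- case: (y == x) => [[<-] //|].
  by case: (subst x t B) IHB => //= B' IHB [<-] /=; rewrite (IHB B').
- case: (y == x) => [[<-] //|].
  by case: (subst x t B) IHB => //= B' IHB [<-] /=; rewrite (IHB B').
Qed.

Lemma QLPm_axiom_unjustified A : QLPm_axiom A -> unjustified_eval A.
Proof.
(* The axioms jK, jT, j4 and Sum close here: their antecedent [Just _ _] is false. Q1 to Q4 become
   instances of [b ==> b] once quantifiers are erased. *)
case=> {A} //=.
- by move=> A /(_ unjustified_eval); rewrite eval_unjustified.
- by move=> x t A At _ /unjustified_eval_subst ->; apply: implybb.
- by move=> _ A B _; apply: implybb.
- by move=> x t A At _ /unjustified_eval_subst ->; apply: implybb.
- by move=> _ A B _; apply: implybb.
Qed.

Lemma QLPm_empty_unjustified F A :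
  unjustified_eval F -> QLPm_empty F A -> unjustified_eval A.
Proof.
move=> F_true; elim=> {A} [A /QLPm_axiom_unjustified||A B _ + _|] //=.
by move=> /implyP.
Qed.

Theorem theorem28 (E : pvar) (x : jvar) :
  ~ QLPm_empty
      (Iff Delta
           (And (PVar E)
                (Neg (Ex x (Just (Var x) (Imp Delta (PVar E)))))))
      (Neg Delta).
(* Both sides of the extra axiom compute to true, whereas [Neg Delta] computes to false. *)
Proof. by move=> pr; apply: (notF (QLPm_empty_unjustified _ _ _ pr)). Qed.
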